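(* Let $R$ be an elementary divisor domain (not necessarily commutative) and let $M$ be an $R$-bimodule such that the trivial extension $R\ltimes M$ is morphic. Then $R\ltimes M$ is strongly morphic.
   Context: Rings are associative with identity. $R\ltimes M=\{(r,m): r\in R,m\in M\}$ with componentwise addition and multiplication $(r_1,m_1)(r_2,m_2)=(r_1r_2,\,r_1m_2+m_1r_2)$. A ring $S$ is left morphic if for every $a\in S$ there is $b\in S$ with $Sa=l(b)$ and $l(a)=Sb$, where $l(\cdot)$ is the left annihilator; right morphic is symmetric; morphic means both. $S$ is strongly morphic if all matrix rings $\mathbb{M}_n(S)$, $n\ge1$, are morphic. A ring $R$ is an elementary divisor ring if for every matrix $A$ over $R$ there exist invertible matrices $P$ and $Q$ over $R$ such that $PAQ=\mathrm{diag}(d_1,d_2,\dots,d_r,0,\dots,0)$ is a diagonal matrix with $Rd_{i+1}R\subseteq d_iR\cap Rd_i$ for $i=1,\dots,r-1$; an elementary divisor domain is a domain that is an elementary divisor ring. *)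

(* Defs.v *)
From HB Require Import structures.
From mathcomp Require Import all_boot all_order all_algebra.

Set Implicit Arguments.
Unset Strict Implicit.
Unset Printing Implicit Defensive.

Import GRing.Theory.
Local Open Scope ring_scope.

(* Unital bimodules over a ring; [ract m r] is the right action m r, the left
   action being the one of lmodType. *)
HB.mixin Record Lmodule_isBimodule (R : pzRingType) M of GRing.Lmodule R M := {
  ract : M -> R -> M;
  ractA : forall m r s, ract (ract m r) s = ract m (r * s);
  ractr1 : forall m, ract m 1 = m;
  ractDl : forall r, {morph ract^~ r : m n / m + n};
  ractDr : forall m, {morph ract m : r s / r + s};
  ractZ : forall r m s, ract (r *: m) s = r *: ract m s
}.

#[short(type="bimodType")]
HB.structure Definition Bimodule (R : pzRingType) :=
  {M of GRing.Lmodule R M & Lmodule_isBimodule R M}.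

(* An alias of the product type, so that its multiplication does not compete
   with the componentwise one. *)
Definition trivext (R : nzRingType) (M : bimodType R) : Type := (R * M)%type.

Section TrivialExtension.
Variables (R : nzRingType) (M : bimodType R).

HB.instance Definition _ := GRing.Zmodule.copy (trivext M) (R * M)%type.

Definition trivext_one : trivext M := (1, 0).
Definition trivext_mul (x y : trivext M) : trivext M :=
  (x.1 * y.1, x.1 *: y.2 + ract x.2 y.1).

Fact trivext_mulA : associative trivext_mul.
Proof.
move=> [a m] [b n] [c p]; congr (_, _) => /=; first exact: mulrA.
by rewrite scalerDr scalerA ractDl ractZ ractA addrA.
Qed.

Fact trivext_mul1 : left_id trivext_one trivext_mul.
Proof.
move=> [a m]; congr (_, _) => /=; first exact: mul1r.
have r0 : ract (0 : M) a = 0.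
  by apply: (addrI (ract (0 : M) a)); rewrite -ractDl !addr0.
by rewrite scale1r r0 addr0.
Qed.

Fact trivext_1mul : right_id trivext_one trivext_mul.
Proof.
move=> [a m]; congr (_, _) => /=; first exact: mulr1.
by rewrite scaler0 ractr1 add0r.
Qed.

Fact trivext_mulDl : left_distributive trivext_mul +%R.
Proof.
move=> [a m] [b n] [c p]; congr (_, _) => /=; first exact: mulrDl.
by rewrite scalerDl ractDl addrACA.
Qed.

Fact trivext_mulDr : right_distributive trivext_mul +%R.
Proof.
move=> [a m] [b n] [c p]; congr (_, _) => /=; first exact: mulrDr.
by rewrite scalerDr ractDr addrACA.
Qed.

Fact trivext_one_neq0 : trivext_one != 0.
Proof. by apply/eqP => -[/eqP]; rewrite oner_eq0. Qed.

HB.instance Definition _ := GRing.Zmodule_isNzRing.Build (trivext M)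
  trivext_mulA trivext_mul1 trivext_1mul trivext_mulDl trivext_mulDr
  trivext_one_neq0.

End TrivialExtension.

Definition left_ideal (S : pzRingType) (a x : S) : Prop := exists s, x = s * a.
Definition right_ideal (S : pzRingType) (a x : S) : Prop := exists s, x = a * s.
Definition left_ann (S : pzRingType) (a x : S) : Prop := x * a = 0.
Definition right_ann (S : pzRingType) (a x : S) : Prop := a * x = 0.

(* S d S is the two-sided ideal generated by d: finite sums of products. *)
Definition twosided_ideal (S : pzRingType) (d x : S) : Prop :=
  exists k (u v : 'I_k -> S), x = \sum_(i < k) u i * d * v i.

Definition left_morphic (S : pzRingType) : Prop :=
  forall a : S, exists b : S,
    (forall x, left_ideal a x <-> left_ann b x) /\
    (forall x, left_ann a x <-> left_ideal b x).

Definition right_morphic (S : pzRingType) : Prop :=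
  forall a : S, exists b : S,
    (forall x, right_ideal a x <-> right_ann b x) /\
    (forall x, right_ann a x <-> right_ideal b x).

Definition morphic (S : pzRingType) : Prop := left_morphic S /\ right_morphic S.

Definition strongly_morphic (S : nzRingType) : Prop :=
  forall n : nat, morphic 'M[S]_n.+1.

(* MathComp's unitmx requires commutative coefficients. *)
Definition invertible_mx (R : pzRingType) n (A : 'M[R]_n) : Prop :=
  exists B : 'M[R]_n, A *m B = 1%:M /\ B *m A = 1%:M.

(* Matrices are rectangular; d 0, ..., d (r - 1) are the r displayed diagonal
   entries, and the values of d beyond r are irrelevant. *)
Definition elementary_divisor_ring (R : pzRingType) : Prop :=
  forall m n (A : 'M[R]_(m, n)),
  exists (P : 'M[R]_m) (Q : 'M[R]_n) (r : nat) (d : nat -> R),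
    [/\ invertible_mx P, invertible_mx Q, (r <= minn m n)%N,
        P *m A *m Q = \matrix_(i < m, j < n)
          (if ((i : nat) == j) && (i < r)%N then d i else 0)
      & forall i, (i.+1 < r)%N -> forall x, twosided_ideal (d i.+1) x ->
          right_ideal (d i) x /\ left_ideal (d i) x].

(* The requirement 1 <> 0 on a domain is carried by nzRingType. *)
Definition elementary_divisor_domain (R : nzRingType) : Prop :=
  (forall a b : R, a * b = 0 -> a = 0 \/ b = 0) /\ elementary_divisor_ring R.

(* Main.v *)
(* Idea: every square matrix over S = R |x M is equivalent to a diagonal one,
   and a diagonal matrix with morphic entries is morphic. To split off one
   diagonal entry of A, diagonalise its projection to R. If the first diagonal
   entry is nonzero, its left and right multiples in S contain all of M, so it
   clears its row and column. Otherwise A has entries in M; morphicity of S then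
   leaves two cases. Either R is a division ring and any nonzero entry of A is a
   pivot, or M is a torsion module. In the torsion case the left annihilator of
   A is free; diagonalising it, one may assume that row i of A is killed exactly
   by R d_i, with R d_k R inside d_i R for i < k. Column operations leave one
   nonzero entry x in the last row, whose left annihilator is then R d_n, and the
   inclusion R d_n R <= d_i R forces the rest of the column of x into S x. *)

From HB Require Import structures.
Require Import Defs.
From mathcomp Require Import all_boot all_order all_algebra fingroup perm.

Set Implicit Arguments.
Unset Strict Implicit.
Unset Printing Implicit Defensive.

Import GRing.Theory.
Local Open Scope ring_scope.

(** * Annihilator mates and their transport along units *)

Section MorphicElements.

Definition left_mate (S : pzRingType) (a b : S) : Prop :=
  (forall x, left_ideal a x <-> left_ann b x) /\
  (forall x, left_ann a x <-> left_ideal b x).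

Definition right_mate (S : pzRingType) (a b : S) : Prop :=
  (forall x, right_ideal a x <-> right_ann b x) /\
  (forall x, right_ann a x <-> right_ideal b x).

(** Right multiplication by [q] carries [S a] onto [S p a q], and right multiplication by [p']
    carries the left annihilator of [a] onto that of [p a q]. *)
Lemma left_mate_unit (S : pzRingType) (p p' q q' a b : S) :
  p * p' = 1 -> p' * p = 1 -> q * q' = 1 -> q' * q = 1 ->
  left_mate (p * a * q) b -> left_mate a (q * b * p).
Proof.
move=> pp' p'p qq' q'q [ideal_ab ann_ab]; split=> x; split.
- case=> s ->; rewrite /left_ann.
  have /ideal_ab : left_ideal (p * a * q) (s * a * q).
    by exists (s * p'); rewrite !mulrA -(mulrA s p') p'p mulr1.
  by rewrite /left_ann !mulrA => ->; rewrite mul0r.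
- rewrite /left_ann => xqbp; have /ideal_ab[s sE] : left_ann b (x * q).
    by rewrite /left_ann -[LHS]mulr1 -pp' -[RHS](mul0r p') -xqbp !mulrA.
  exists (s * p); rewrite -[x]mulr1 -qq' mulrA sE !mulrA.
  by rewrite -(mulrA _ q) qq' mulr1.
- rewrite /left_ann => xa; have /ann_ab[s sE] : left_ann (p * a * q) (x * p').
    by rewrite /left_ann !mulrA -(mulrA x p') p'p mulr1 xa mul0r.
  exists (s * q'); rewrite -[LHS]mulr1 -p'p mulrA sE !mulrA.
  by rewrite -(mulrA s q') q'q mulr1.
- case=> s ->; rewrite /left_ann.
  have /ann_ab : left_ideal b (s * q * b) by exists (s * q).
  rewrite /left_ann !mulrA => sqbpaq.
  by rewrite -[LHS]mulr1 -qq' mulrA sqbpaq mul0r.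
Qed.

Lemma right_mate_unit (S : pzRingType) (p p' q q' a b : S) :
  p * p' = 1 -> p' * p = 1 -> q * q' = 1 -> q' * q = 1 ->
  right_mate (p * a * q) b -> right_mate a (q * b * p).
Proof.
rewrite -(mulrA p) -(mulrA q) => pp' p'p qq' q'q.
exact: (@left_mate_unit S^c q q' p p' a b).
Qed.

End MorphicElements.

(** * Diagonal matrices with morphic entries *)

Section DiagonalMorphic.
Variables (S : pzRingType) (n : nat).

Lemma left_mate_diag (d e : 'rV[S]_n) :
  (forall i, left_mate (d 0 i) (e 0 i)) ->
  left_mate (diag_mx d : 'M[S]_n) (diag_mx e).
Proof.
move=> de.
(* Both conditions are entrywise, as column [j] of [X] only meets the [j]-th diagonal entry. This
   serves for the pair [d], [e] and again with the two exchanged. *)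
have ideal_ann (f g : 'rV[S]_n) (X : 'M_n) :
    (forall i x, left_ideal (f 0 i) x <-> left_ann (g 0 i) x) ->
  left_ideal (diag_mx f : 'M[S]_n) X <-> left_ann (diag_mx g : 'M[S]_n) X.
  move=> fg; split=> [[s ->]|XG].
    apply/matrixP=> i j; rewrite -!mulmxE !mul_mx_diag !mxE.
    by apply/fg; exists (s i j).
  have /fin_all_exists[s sE] ij : exists s, X ij.1 ij.2 = s * f 0 ij.2.
    apply/fg; move/matrixP/(_ ij.1 ij.2): XG.
    by rewrite -mulmxE mul_mx_diag !mxE.
  exists (\matrix_(i, j) s (i, j)); apply/matrixP=> i j.
  by rewrite -mulmxE mul_mx_diag !mxE -(sE (i, j)).
split=> X; first by apply: ideal_ann => i; case: (de i).
by apply: iff_sym; apply: ideal_ann => i x; apply: iff_sym; case: (de i).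
Qed.

Lemma right_mate_diag (d e : 'rV[S]_n) :
  (forall i, right_mate (d 0 i) (e 0 i)) ->
  right_mate (diag_mx d : 'M[S]_n) (diag_mx e).
Proof.
move=> de.
have ideal_ann (f g : 'rV[S]_n) (X : 'M_n) :
    (forall i x, right_ideal (f 0 i) x <-> right_ann (g 0 i) x) ->
  right_ideal (diag_mx f : 'M[S]_n) X <-> right_ann (diag_mx g : 'M[S]_n) X.
  move=> fg; split=> [[s ->]|XG].
    apply/matrixP=> i j; rewrite -!mulmxE !mul_diag_mx !mxE.
    by apply/fg; exists (s i j).
  have /fin_all_exists[s sE] ij : exists s, X ij.1 ij.2 = f 0 ij.1 * s.
    apply/fg; move/matrixP/(_ ij.1 ij.2): XG.
    by rewrite -mulmxE mul_diag_mx !mxE.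
  exists (\matrix_(i, j) s (i, j)); apply/matrixP=> i j.
  by rewrite -mulmxE mul_diag_mx !mxE -(sE (i, j)).
split=> X; first by apply: ideal_ann => i; case: (de i).
by apply: iff_sym; apply: ideal_ann => i x; apply: iff_sym; case: (de i).
Qed.

End DiagonalMorphic.

(** * Matrix equivalence and splitting off a diagonal entry *)

Section Equivalence.
Variable S : pzRingType.

Definition equiv_mx n (A B : 'M[S]_n) : Prop :=
  exists P Q, [/\ invertible_mx P, invertible_mx Q & B = P *m A *m Q].

Lemma invertible_mx1 n : invertible_mx (1%:M : 'M[S]_n).
Proof. by exists 1%:M; rewrite mulmx1. Qed.

Lemma invertible_mxM n (A B : 'M[S]_n) :
  invertible_mx A -> invertible_mx B -> invertible_mx (A *m B).
Proof.
move=> [A' [AA' A'A]] [B' [BB' B'B]]; exists (B' *m A'); split.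
  by rewrite mulmxA -(mulmxA A) BB' mulmx1.
by rewrite mulmxA -(mulmxA B') A'A mulmx1.
Qed.

Lemma invertible_tperm_mx n (i j : 'I_n) :
  invertible_mx (tperm_mx i j : 'M[S]_n).
Proof. by exists (tperm_mx i j); rewrite -perm_mxM tperm2 perm_mx1. Qed.

Lemma invertible_block_diag m n (A : 'M[S]_m) (B : 'M[S]_n) :
  invertible_mx A -> invertible_mx B -> invertible_mx (block_mx A 0 0 B).
Proof.
move=> [A' [AA' A'A]] [B' [BB' B'B]]; exists (block_mx A' 0 0 B').
rewrite !mulmx_block !(mulmx0, mul0mx, addr0, add0r) AA' A'A BB' B'B.
by rewrite -scalar_mx_block.
Qed.

Lemma invertible_block_lower m n (C : 'M[S]_(n, m)) :
  invertible_mx (block_mx 1%:M 0 C 1%:M).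
Proof.
exists (block_mx 1%:M 0 (- C) 1%:M).
rewrite !mulmx_block !(mulmx0, mul0mx, mul1mx, mulmx1, addr0, add0r).
by rewrite addrN addNr -scalar_mx_block.
Qed.

Lemma invertible_block_upper m n (C : 'M[S]_(m, n)) :
  invertible_mx (block_mx 1%:M C 0 1%:M).
Proof.
exists (block_mx 1%:M (- C) 0 1%:M).
rewrite !mulmx_block !(mulmx0, mul0mx, mul1mx, mulmx1, addr0, add0r).
by rewrite addrN addNr -scalar_mx_block.
Qed.

Lemma equiv_mx_trans n (A B C : 'M[S]_n) :
  equiv_mx A B -> equiv_mx B C -> equiv_mx A C.
Proof.
move=> [P [Q [invP invQ ->]]] [P' [Q' [invP' invQ' ->]]].
exists (P' *m P), (Q *m Q'); split; try exact: invertible_mxM.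
by rewrite !mulmxA.
Qed.

Lemma equiv_mx_mul n (P A Q : 'M[S]_n) :
  invertible_mx P -> invertible_mx Q -> equiv_mx A (P *m A *m Q).
Proof. by move=> invP invQ; exists P, Q. Qed.

Lemma equiv_mx_block m n (A : 'M[S]_m) (B C : 'M[S]_n) :
  equiv_mx B C -> equiv_mx (block_mx A 0 0 B) (block_mx A 0 0 C).
Proof.
move=> [P [Q [invP invQ ->]]].
exists (block_mx 1%:M 0 0 P), (block_mx 1%:M 0 0 Q).
split; try by apply: invertible_block_diag => //; exact: invertible_mx1.
by rewrite !mulmx_block !(mulmx0, mul0mx, mul1mx, mulmx1, addr0, add0r).
Qed.

(** Block elimination: the rest of the first row is [x r] and of the first column [c x], so clearing
    both leaves [drsubmx A - c x r] in the corner. *)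
Lemma equiv_mx_clear n (A : 'M[S]_(1 + n)) :
  (forall j, right_ideal (A 0 0) (A 0 j)) ->
  (forall i, left_ideal (A 0 0) (A i 0)) ->
  exists A', equiv_mx A (block_mx (A 0 0)%:M 0 0 A').
Proof.
move=> /fin_all_exists[v vE] /fin_all_exists[u uE].
set x := A 0 0 in vE uE *.
pose r : 'rV_n := \row_j v (rshift 1 j); pose c : 'cV_n := \col_i u (rshift 1 i).
have AE : A = block_mx x%:M (x%:M *m r) (c *m x%:M) (drsubmx A).
  rewrite -[LHS]submxK; congr block_mx; apply/matrixP=> i j; rewrite !mxE.
  - by rewrite !ord1 mulr1n; congr (A _ _); apply: val_inj.
  - rewrite big_ord1 !mxE !ord1 mulr1n -vE.
    by congr (A _ _); apply: val_inj.
  - rewrite big_ord1 !mxE !ord1 mulr1n -uE.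
    by congr (A _ _); apply: val_inj.
exists (drsubmx A - c *m x%:M *m r); rewrite {1}AE.
exists (block_mx 1%:M 0 (- c) 1%:M), (block_mx 1%:M (- r) 0 1%:M); split.
- exact: invertible_block_lower.
- exact: invertible_block_upper.
- rewrite !mulmx_block.
  rewrite !(mulmx0, mul0mx, mul1mx, mulmx1, addr0, add0r, mulmxN, mulNmx).
  by rewrite !addNr mul0mx oppr0 add0r mulmxA addrC.
Qed.

Lemma equiv_mx_pivot n (A : 'M[S]_(1 + n)) i0 j0 :
  (forall j, right_ideal (A i0 j0) (A i0 j)) ->
  (forall i, left_ideal (A i0 j0) (A i j0)) ->
  exists x A', equiv_mx A (block_mx x%:M 0 0 A').
Proof.
move=> rowA colA; pose B := xcol 0 j0 (xrow 0 i0 A).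
have AB : equiv_mx A B.
  rewrite /B xcolE xrowE.
  by apply: equiv_mx_mul; apply: invertible_tperm_mx.
have BE i j : B i j = A (tperm 0 i0 i) (tperm 0 j0 j) by rewrite !mxE.
have B00 : B 0 0 = A i0 j0 by rewrite BE !tpermL.
have [|i|B' BB'] := @equiv_mx_clear _ B.
- by move=> j; rewrite B00 BE tpermL.
- by rewrite B00 BE tpermL.
- by exists (B 0 0), B'; apply: equiv_mx_trans BB'.
Qed.

Lemma left_mate_equiv n (A D : 'M[S]_n) :
  equiv_mx A D -> (exists B, left_mate D B) -> exists B, left_mate A B.
Proof.
move=> [P [Q [[P' [PP' P'P]] [Q' [QQ' Q'Q]] ->]]] [B DB].
by exists (Q * B * P); apply: left_mate_unit DB; eassumption.
Qed.

Lemma right_mate_equiv n (A D : 'M[S]_n) :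
  equiv_mx A D -> (exists B, right_mate D B) -> exists B, right_mate A B.
Proof.
move=> [P [Q [[P' [PP' P'P]] [Q' [QQ' Q'Q]] ->]]] [B DB].
by exists (Q * B * P); apply: right_mate_unit DB; eassumption.
Qed.

Lemma morphic_diagonalizable n :
  morphic S -> (forall A : 'M[S]_n, exists d, equiv_mx A (diag_mx d)) ->
  morphic 'M[S]_n.
Proof.
move=> [morl morr] diag; split=> A; have [d Ad] := diag A.
  have /fin_all_exists[e eE] i : exists b, left_mate (d 0 i) b by apply: morl.
  apply: left_mate_equiv Ad _; exists (diag_mx (\row_i e i)).
  by apply: left_mate_diag => i; rewrite mxE.
have /fin_all_exists[e eE] i : exists b, right_mate (d 0 i) b by apply: morr.
apply: right_mate_equiv Ad _; exists (diag_mx (\row_i e i)).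
by apply: right_mate_diag => i; rewrite mxE.
Qed.

Lemma diagonalizable_split :
  (forall n (A : 'M[S]_(1 + n)), exists x A', equiv_mx A (block_mx x%:M 0 0 A')) ->
  forall n (A : 'M[S]_n), exists d, equiv_mx A (diag_mx d).
Proof.
move=> split1; elim=> [|n IHn] A.
  exists 0, 1%:M, 1%:M; split; try exact: invertible_mx1.
  by apply/matrixP=> -[].
have [x [A' AA']] := split1 n A; have [d A'd] := IHn A'.
exists (row_mx (x%:M : 'rV_1) d).
have -> : diag_mx (row_mx (x%:M : 'rV_1) d) = block_mx x%:M 0 0 (diag_mx d).
  rewrite diag_mx_row; congr block_mx.
  by apply/matrixP=> i j; rewrite !mxE !ord1 eqxx mulr1n.
exact: equiv_mx_trans AA' (equiv_mx_block _ A'd).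
Qed.

End Equivalence.

(** * One-sided consequences of morphicity over a square-zero kernel *)

(* [pi] is a mere function and multiplicativity a hypothesis so that the section
   also applies to the converse rings, which gives the right-handed versions. *)
Section OneSided.
Variables (T K : nzRingType) (pi : T -> K).
Hypothesis piM : forall x y, pi (x * y) = pi x * pi y.
Hypothesis pi0 : pi 0 = 0.
Hypothesis domK : forall a b : K, a * b = 0 -> a = 0 \/ b = 0.
Hypothesis kerM : forall x y, pi x = 0 -> pi y = 0 -> x * y = 0.
Hypothesis morT : left_morphic T.

(** When [pi] is a surjective ring morphism, this forces [K] to be a division ring. *)
Definition left_inverses := forall t, pi t != 0 -> exists s, s * t = 1.

Lemma left_mate_annl (a b : T) : left_mate a b -> b * a = 0.
Proof. by move=> [_ ann_ab]; apply/ann_ab; exists 1; rewrite mul1r. Qed.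

Lemma left_mate_annr (a b : T) : left_mate a b -> a * b = 0.
Proof. by move=> [ideal_ab _]; apply/ideal_ab; exists 1; rewrite mul1r. Qed.

Lemma pi_eq0M x y : pi (x * y) = 0 -> pi x != 0 -> pi y = 0.
Proof. by rewrite piM => /domK[->|//]; rewrite eqxx. Qed.

Lemma pi_eq0Mr x y : pi (x * y) = 0 -> pi y != 0 -> pi x = 0.
Proof. by rewrite piM => /domK[//|->]; rewrite eqxx. Qed.

Lemma left_mate_ker (a b : T) : left_mate a b -> pi a != 0 -> pi b = 0.
Proof. by move=> /left_mate_annl ba0; apply: pi_eq0Mr; rewrite ba0. Qed.

(** The mate [b] of [a] lies in the kernel, so [x b] is a product of two kernel elements, and [T a]
    is the annihilator of [b]. *)
Lemma ker_left_ideal a x : pi a != 0 -> pi x = 0 -> left_ideal a x.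
Proof.
move=> a0 x0; have [b ab] := morT a; apply/(proj1 ab).
by apply: kerM => //; apply: left_mate_ker a0.
Qed.

(** If the mate [b] of [x] is outside the kernel, it kills [x]. Otherwise [T x] contains the kernel,
    in particular the mate [c = s x] of [a]; then [a s] kills [x], so it lies in [T b], which puts
    [s] in the kernel and gives [c = 0], that is [T a = T]. *)
Lemma left_torsion_or_inverses x : pi x = 0 ->
  (exists2 t, pi t != 0 & t * x = 0) \/ left_inverses.
Proof.
move=> x0; have [b xb] := morT x.
have [b0|/eqP b0] := eqVneq (pi b) 0; last first.
  by left; exists b; [exact/eqP | exact: left_mate_annl].
right=> a a0; have [c ac] := morT a.
have c0 : pi c = 0 by apply: left_mate_ker a0.
suff cE : c = 0.
  by have [] := proj1 ac 1; rewrite /left_ann cE mulr0 => _ /(_ erefl) [s]; exists s.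
have /(proj1 xb) [s cE] : left_ann b c by apply: kerM.
have asx : left_ann x (a * s) by rewrite /left_ann -mulrA -cE left_mate_annr.
have [t asE] := iffLR (proj2 xb _) asx.
rewrite cE; apply: kerM => //; apply: pi_eq0M a0.
by rewrite asE piM b0 mulr0.
Qed.

Lemma left_common_torsion_or_inverses (xs : seq T) :
  {in xs, forall x, pi x = 0} ->
  (exists2 t, pi t != 0 & {in xs, forall x, t * x = 0}) \/ left_inverses.
Proof.
elim: xs => [|x xs IHxs] xs0.
  (* [pi] is only multiplicative here, so [1] is a witness for the empty list only once [pi 1] is
     known to be nonzero. *)
  have [/left_torsion_or_inverses|] := eqVneq (pi 1) 0.
    by case=> [[t t0 _]|]; [left; exists t | right].
  by left; exists 1.
have [y yxs|[t t0 txs]|?] := IHxs; last by right.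
  by apply: xs0; rewrite inE yxs orbT.
have tx0 : pi (t * x) = 0 by rewrite piM (xs0 x) ?mulr0 ?mem_head.
have [[u u0 utx]|?] := left_torsion_or_inverses tx0; last by right.
left; exists (u * t); first by apply: contra_neq t0 => /pi_eq0M; apply.
move=> y; rewrite inE -mulrA => /predU1P[->//|yxs].
by rewrite txs ?mulr0.
Qed.

(** The mate of [x] kills [x], so it cannot be left invertible; hence it lies in the kernel and is
    killed by [y]. *)
Lemma inverses_ker_left_ideal x y :
  left_inverses -> pi x = 0 -> x != 0 -> pi y = 0 -> left_ideal x y.
Proof.
move=> invT x0 xn0 y0; have [b xb] := morT x.
have [b0|/invT[s sb]] := eqVneq (pi b) 0.
  by apply/(proj1 xb); apply: kerM.
by case/eqP: xn0; rewrite -[x]mul1r -sb -mulrA (left_mate_annl xb) mulr0.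
Qed.

End OneSided.

(** * Matrices over an elementary divisor domain *)

Section ElementaryDivisor.
Variable R : nzRingType.
Hypothesis domR : forall a b : R, a * b = 0 -> a = 0 \/ b = 0.
Hypothesis edrR : elementary_divisor_ring R.

(** Setting [d] to zero from [r] on lets the inclusion of [R d_k] in [d_i R] hold for all
    [i < k]. *)
Lemma elementary_divisor_chain m n (A : 'M[R]_(m, n)) :
  exists (P : 'M_m) (Q : 'M_n) (d : nat -> R),
  [/\ invertible_mx P, invertible_mx Q,
      P *m A *m Q = \matrix_(i < m, j < n) (d i *+ ((i : nat) == j))
    & forall i k c, (i < k)%N -> right_ideal (d i) (c * d k)].
Proof.
have [P [Q [r [d [invP invQ _ PAQ chain]]]]] := edrR A.
exists P, Q, (fun i => d i *+ (i < r)%N); split=> // [|i k c].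
  by rewrite PAQ; apply/matrixP=> i j; rewrite !mxE -mulrnA mulnb andbC;
     case: ifP.
case: (ltnP k r) => [kr|_ _]; last by exists 0; rewrite !mulr0.
elim: k c kr => // k IHk c kr.
have two e f : twosided_ideal (d k.+1) (e * d k.+1 * f).
  by exists 1, (fun=> e), (fun=> f); rewrite big_ord1.
rewrite ltnS leq_eqVlt => /predU1P[->|ik].
  rewrite (ltn_trans _ kr) //.
  by have [+ _] := chain _ kr _ (two c 1); rewrite mulr1.
(* The left-ideal half of the hypothesis turns [d k.+1] into [s * d k], and the factor [s] is
   absorbed into [c]. *)
have [_ [s]] := chain _ kr _ (two 1 1); rewrite mul1r mulr1 mulr1n => ->.
by rewrite mulrA; apply: IHk => //; apply: ltnW.
Qed.

(** A diagonal matrix with one row has at most its first entry nonzero, and undoing the left factor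
    of size 1 preserves the zeros. *)
Lemma row_reduce n (c : 'rV[R]_(1 + n)) :
  exists2 Q : 'M_(1 + n), invertible_mx Q & forall j, j != 0 -> (c *m Q) 0 j = 0.
Proof.
have [P [Q [d [[P' [_ P'P]] invQ PcQ _]]]] := elementary_divisor_chain c.
exists Q => // j j0; rewrite -[c]mul1mx -P'P -!mulmxA (mulmxA P) PcQ !mxE.
rewrite big_ord1 !mxE; case: eqP => [j0'|_]; last by rewrite mulr0.
by case/eqP: j0; apply: val_inj.
Qed.

(* The rows [r] with [r C] in [R^n a] are the tails of the rows killing the
   matrix [a I] stacked on [C]; as [a != 0] that matrix has rank [n], so they
   form a free module of rank [m]. *)
Lemma row_colon_ideal m n (C : 'M[R]_(m, n)) a : a != 0 ->
  exists B : 'M_m, forall r : 'rV_m,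
    (exists t : 'rV_n, r *m C = t *m a%:M) <-> (exists w : 'rV_m, r = w *m B).
Proof.
move=> a0; pose A : 'M_(n + m, n) := col_mx a%:M C.
have [P [Q [d [[P' [_ P'P]] [Q' [QQ' Q'Q]] PAQ _]]]] :=
  elementary_divisor_chain A.
set D := \matrix_(i, j) _ in PAQ.
have PA : P *m A = D *m Q' by rewrite -PAQ -(mulmxA _ Q) QQ' mulmx1.
(* If [d j = 0], column [j] of [Q] is killed by [A], hence by its upper block [a I]; in a domain
   that column would vanish. *)
have d0 (j : 'I_n) : d j != 0.
  apply/eqP=> dj0.
  have Dj : D *m delta_mx j (0 : 'I_1) = 0.
    rewrite -colE; apply/matrixP=> i k; rewrite !mxE.
    by case: eqP => [->|//]; rewrite dj0.
  have /(congr1 usubmx) : A *m (Q *m delta_mx j (0 : 'I_1)) = 0.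
    by rewrite mulmxA -[A]mul1mx -P'P -!mulmxA (mulmxA P) (mulmxA _ Q) PAQ Dj mulmx0.
  rewrite mul_col_mx col_mxKu mul_scalar_mx linear0 => aQ.
  have Qj : Q *m delta_mx j (0 : 'I_1) = 0.
    apply/matrixP=> i k; move/matrixP/(_ i k): aQ; rewrite !mxE => /domR[|//].
    by move/eqP; rewrite (negPf a0).
  have /matrixP/(_ j 0) : delta_mx j (0 : 'I_1) = 0 :> 'M[R]_(n, 1).
    by rewrite -[LHS]mul1mx -Q'Q -mulmxA Qj mulmx0.
  by rewrite !mxE !eqxx => /eqP; rewrite oner_eq0.
have Dd k j : D (rshift n k) j = 0.
  by rewrite mxE gtn_eqF //= (leq_trans (ltn_ord j)) ?leq_addr.
have Du k j : D (lshift m k) j = d k *+ (k == j) by rewrite mxE.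
have D0 (w : 'rV_m) : row_mx 0 w *m D = 0.
  apply/matrixP=> i j; rewrite !mxE big_split_ord /= !big1 ?addr0 // => k _.
    by rewrite Dd mulr0.
  by rewrite row_mxEl mxE mul0r.
(* With [D0], the left kernel of [D] is exactly the rows supported on the last [m] coordinates, so
   the last [m] rows of [P] span the left kernel of [A]. *)
have kerD (w : 'rV_(n + m)) : w *m D = 0 -> lsubmx w = 0.
  move=> wD; apply/matrixP=> i j; move/matrixP/(_ i j): wD; rewrite !mxE.
  rewrite big_split_ord /= [X in _ + X]big1 ?addr0; last first.
    by move=> k _; rewrite Dd mulr0.
  rewrite (bigD1 j) //= big1 ?addr0; last first.
    by move=> k kj; rewrite Du (negPf kj) mulr0.
  by rewrite Du eqxx => /domR[//|/eqP]; rewrite (negPf (d0 j)).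
exists (rsubmx (dsubmx P)) => r; split=> [[t rC]|[w ->]].
  pose z := row_mx (- t) r; pose w : 'rV_(n + m) := z *m P'.
  have wD : w *m D = 0.
    rewrite -PAQ /w !mulmxA -(mulmxA z) P'P mulmx1 mul_row_col rC mulNmx.
    by rewrite addNr mul0mx.
  exists (rsubmx w).
  have zE : z = rsubmx w *m dsubmx P.
    rewrite -[z]mulmx1 -P'P mulmxA -/w -[w in LHS]hsubmxK -[P in LHS]vsubmxK.
    by rewrite mul_row_col (kerD _ wD) mul0mx add0r.
  by rewrite mulmx_rsub -zE row_mxKr.
pose z := row_mx 0 w *m P; exists (- lsubmx z).
have : z *m A = 0 by rewrite /z -mulmxA PA mulmxA D0 mul0mx.
have -> : w *m rsubmx (dsubmx P) = rsubmx z.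
  rewrite /z -[P in RHS]vsubmxK mul_row_col mul0mx add0r.
  by rewrite mulmx_rsub.
rewrite -[z in z *m A]hsubmxK mul_row_col => /eqP.
by rewrite addrC addr_eq0 mulNmx => /eqP.
Qed.

End ElementaryDivisor.

(** * Diagonalisation over a split extension with square-zero kernel *)

Section SplitExtension.
Variables (S R : nzRingType) (pi : {rmorphism S -> R}) (iota : {rmorphism R -> S}).
Hypothesis iotaK : cancel iota pi.
Hypothesis kerM : forall x y, pi x = 0 -> pi y = 0 -> x * y = 0.
Hypothesis domR : forall a b : R, a * b = 0 -> a = 0 \/ b = 0.
Hypothesis edrR : elementary_divisor_ring R.
Hypothesis morS : morphic S.

Let piM : forall x y, pi (x * y) = pi x * pi y. Proof. exact: rmorphM. Qed.
Let pi0 : pi 0 = 0. Proof. exact: rmorph0. Qed.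
Let piMc : forall x y : S^c, pi (x * y) = (pi x : R^c) * pi y.
Proof. by move=> x y; exact: rmorphM. Qed.
Let kerMc : forall x y : S^c, pi x = 0 -> pi y = 0 -> x * y = 0.
Proof. by move=> x y x0 y0; exact: kerM y0 x0. Qed.
Let domRc : forall a b : R^c, a * b = 0 -> a = 0 \/ b = 0.
Proof. by move=> a b /domR[]; [right | left]. Qed.

Lemma invertible_iota n (A : 'M[R]_n) :
  invertible_mx A -> invertible_mx (map_mx iota A).
Proof.
by move=> [B [AB BA]]; exists (map_mx iota B); rewrite -!map_mxM AB BA map_mx1.
Qed.

Lemma pi_iota_mx m n (A : 'M[R]_(m, n)) : map_mx pi (map_mx iota A) = A.
Proof. by apply/matrixP=> i j; rewrite !mxE iotaK. Qed.

(** A left inverse of [t] is outside the kernel, so it has a left inverse too, which must be [t]. *)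
Lemma left_inverses_op :
  left_inverses pi -> @left_inverses S^c R^c pi.
Proof.
move=> invS t t0; have [s st] := invS t t0.
have [|s' ss'] := invS s.
  apply/eqP=> s0; move/(congr1 pi): st.
  by rewrite rmorphM rmorph1 s0 mul0r => /eqP; rewrite eq_sym oner_eq0.
by exists s; rewrite -[RHS]ss' -[s' in RHS]mulr1 -st mulrA ss' mul1r.
Qed.

Lemma op_left_inverses :
  @left_inverses S^c R^c pi -> left_inverses pi.
Proof.
move=> invS t t0; have [s ts] := invS t t0.
have [|s' ss'] := invS s.
  apply/eqP=> s0; move/(congr1 pi): ts.
  by rewrite rmorphM rmorph1 s0 mulr0 => /eqP; rewrite eq_sym oner_eq0.
have ts' : t = s' by rewrite -[t]mulr1 -[1]ss' [t * _]mulrA [t * s]ts mul1r.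
by exists s; rewrite ts'.
Qed.

(** With [n0] the left mate of [a], [X = C n0]; so [r X = 0] says that the entries of [r C] lie in
    [S a]. This depends only on [pi r] and describes a row module [R^m B]; diagonalising [B] gives
    [d]. *)
Lemma annihilator_chain m n (X : 'M[S]_(m, n)) a :
  pi a != 0 -> (forall i j, X i j * a = 0) ->
  exists (P Q : 'M[R]_m) (d : nat -> R),
  [/\ P *m Q = 1%:M, Q *m P = 1%:M,
      forall i k c, (i < k)%N -> right_ideal (d i) (c * d k)
    & forall s : 'rV[S]_m, s *m map_mx iota P *m X = 0 <->
        forall i : 'I_m, left_ideal (d i) (pi (s 0 i))].
Proof.
move=> a0 Xa; have [n0 an0] := proj1 morS a.
have pn0 : pi n0 = 0 by apply: (left_mate_ker piM pi0 domR) an0 a0.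
have /fin_all_exists[C CE] ij : exists c, X ij.1 ij.2 = c * n0.
  exact/(proj2 an0)/Xa.
pose Cm : 'M_(m, n) := \matrix_(i, j) C (i, j).
have XE (r : 'rV_m) j : (r *m X) 0 j = (r *m Cm) 0 j * n0.
  rewrite !mxE mulr_suml; apply: eq_bigr => i _.
  by rewrite !mxE (CE (i, j)) mulrA.
have [B BP] := row_colon_ideal domR edrR (map_mx pi Cm) a0.
have annX (r : 'rV_m) : r *m X = 0 <-> exists w, map_mx pi r = w *m B.
  split=> [rX|/BP[t rC]].
    apply/BP; have /fin_all_exists[t tE] j : exists s, (r *m Cm) 0 j = s * a.
      by apply/(proj1 an0); rewrite /left_ann -XE rX mxE.
    exists (\row_j pi (t j)); rewrite -map_mxM; apply/matrixP=> i j.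
    by rewrite -diag_const_mx mul_mx_diag !mxE ord1 -rmorphM -tE mxE.
  apply/matrixP=> i j; rewrite ord1 XE [RHS]mxE.
  (* The entry differs from a multiple of [a] by a kernel element, and [n0] kills both on the
     right. *)
  rewrite -[_ 0 j](subrK (iota (t 0 j) * a)) mulrDl -mulrA.
  rewrite (left_mate_annr an0) mulr0 addr0 kerM // rmorphB rmorphM /= iotaK.
  move/matrixP/(_ 0 j): rC; rewrite -map_mxM -diag_const_mx mul_mx_diag !mxE => ->.
  by rewrite subrr.
have [P1 [Q1 [d [[P1' [P1P1' P1'P1]] [Q1' [Q1Q1' Q1'Q1]] PBQ chain]]]] :=
  elementary_divisor_chain edrR B.
(* Only the right factor changes coordinates; [P1] is absorbed into the arbitrary row [w]. *)
exists Q1', Q1, d; split=> // s.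
set D := \matrix_(i, j) _ in PBQ.
have DE (w : 'rV_m) : w *m D = \row_i (w 0 i * d i).
  have -> : D = diag_mx (\row_i d i) by apply/matrixP=> i j; rewrite !mxE.
  by rewrite mul_mx_diag; apply/matrixP=> i j; rewrite !mxE ord1.
have BQ : B *m Q1 = P1' *m D by rewrite -PBQ !mulmxA P1'P1 mul1mx.
have BE : B = P1' *m D *m Q1' by rewrite -BQ -mulmxA Q1Q1' mulmx1.
apply: iff_trans (annX _) _; rewrite map_mxM pi_iota_mx; split=> [[w sQ] i|dvd_s].
  exists ((w *m P1') 0 i).
  have /matrixP/(_ 0 i) : map_mx pi s = w *m P1' *m D.
    by rewrite -mulmxA -BQ mulmxA -sQ -mulmxA Q1'Q1 mulmx1.
  by rewrite DE !mxE.
have /fin_all_exists[w wE] i := dvd_s i.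
exists ((\row_i w i) *m P1); rewrite BE !mulmxA -(mulmxA _ P1) P1P1' mulmx1 DE.
by congr (_ *m _); apply/matrixP=> i j; rewrite !mxE ord1 wE.
Qed.

(** Here every nonzero kernel element generates the kernel on both sides, so any nonzero entry is a
    pivot. *)
Lemma pivot_of_inverses n (A : 'M[S]_(1 + n)) :
  left_inverses pi -> (forall i j, pi (A i j) = 0) ->
  exists x A', equiv_mx A (block_mx x%:M 0 0 A').
Proof.
move=> invS A0; have [->|/matrix0Pn[i0 [j0 Aij]]] := eqVneq A 0.
  exists 0, 0, 1%:M, 1%:M; split; try exact: invertible_mx1.
  by rewrite mulmx1 mul1mx raddf0 block_mx0.
apply: (equiv_mx_pivot (i0 := i0) (j0 := j0)) => k.
  exact: (@inverses_ker_left_ideal S^c R^c pi kerMc (proj2 morS) _ _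
            (left_inverses_op invS)).
exact: (inverses_ker_left_ideal kerM (proj1 morS) invS).
Qed.

(** Outside the invertible case, a common right annihilator [a] of the entries provides the chain
    [d], and a common left annihilator [t] of the transformed matrix [Y] makes every [d i]
    nonzero. *)
Lemma ker_mx_pivot n (A : 'M[S]_(1 + n)) :
  (forall i j, pi (A i j) = 0) ->
  exists x A', equiv_mx A (block_mx x%:M 0 0 A').
Proof.
move=> A0; pose entries (Y : 'M[S]_(1 + n)) := codom (fun ij => Y ij.1 ij.2).
have [|[a a0 Aa]|/op_left_inverses invS] :=
    @left_common_torsion_or_inverses S^c R^c pi piMc pi0 domRc kerMc (proj2 morS)
      (entries A).
- by move=> _ /codomP[ij ->].
- have {}Aa i j : A i j * a = 0 by apply: Aa; exact: (codom_f _ (i, j)).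
  have [P [P' [d [PP' P'P chain annY]]]] := annihilator_chain a0 Aa.
  pose Y := map_mx iota P *m A.
  have Y0 i j : pi (Y i j) = 0.
    by rewrite mxE rmorph_sum big1 // => k _; rewrite rmorphM /= A0 mulr0.
  (* The description of the annihilator is tested on a row vector supported at [i]. *)
  have annYi i s : (forall j, s * Y i j = 0) <-> left_ideal (d i) (pi s).
    pose r : 'rV[S]_(1 + n) := \row_k (s *+ (k == i)).
    have rY j : (r *m Y) 0 j = s * Y i j.
      rewrite mxE (bigD1 i) //= big1 ?addr0 => [|k /negPf ki].
        by rewrite mxE eqxx.
      by rewrite mxE ki mul0r.
    have rY0 : (forall j, s * Y i j = 0) <-> r *m Y = 0.
      split=> [sY|rY0 j]; last by rewrite -rY rY0 mxE.
      by apply/matrixP=> k j; rewrite ord1 rY sY mxE.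
    apply: iff_trans rY0 _; rewrite mulmxA; apply: iff_trans (annY _) _.
    split=> [/(_ i)|di k]; first by rewrite mxE eqxx.
    by rewrite mxE; case: eqP => [->//|_]; exists 0; rewrite mul0r rmorph0.
  have [|[t t0 tY]|invS] :=
    left_common_torsion_or_inverses piM pi0 domR kerM (proj1 morS) (xs := entries Y).
  + by move=> _ /codomP[ij ->].
  + have d0 (i : 'I_(1 + n)) : d i != 0.
      have [|u tE] := iffLR (annYi i t).
        by move=> j; apply: tY; exact: (codom_f _ (i, j)).
      by apply: contra_neq t0 => di0; rewrite tE di0 mulr0.
    pose i0 : 'I_(1 + n) := ord_max.
    have mate_d (i : 'I_(1 + n)) :
        exists2 m, pi m = 0 & right_mate (iota (d i)) m.
      have [m dm] := proj2 morS (iota (d i)); exists m => //.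
      apply: (@left_mate_ker S^c R^c pi piMc pi0 domRc _ _ dm).
      by rewrite iotaK.
    have dY (i : 'I_(1 + n)) j : iota (d i) * Y i j = 0.
      by move: j; apply/annYi; exists 1; rewrite iotaK mul1r.
    have [m pm dm] := mate_d i0.
    have /fin_all_exists[c cE] j : exists c, Y i0 j = m * c.
      exact/(proj2 dm)/dY.
    (* The last row is [m c] with [m] in the kernel, so only [pi c] matters and column operations
       over [R] suffice. *)
    have [Q [Q' [QQ' Q'Q]] cQ] := row_reduce edrR (\row_j pi (c j)).
    pose Z := Y *m map_mx iota Q.
    have ZQ' : Z *m map_mx iota Q' = Y by rewrite -mulmxA -map_mxM QQ' map_mx1 mulmx1.
    have Zi0 j : j != 0 -> Z i0 j = 0.
      move=> j0; have -> : Z i0 j = m * \sum_k c k * iota (Q k j).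
        rewrite mxE mulr_sumr; apply: eq_bigr => k _.
        by rewrite cE mxE mulrA.
      apply: kerM => //; rewrite rmorph_sum -[RHS](cQ j j0) mxE.
      by apply: eq_bigr => k _; rewrite rmorphM /= iotaK mxE.
    have AZ : equiv_mx A Z.
      by apply: equiv_mx_mul; apply: invertible_iota; [exists P' | exists Q'].
    (* [b] kills the pivot, hence the whole last row, so [pi b = u * d i0]. *)
    have [b xb] := proj1 morS (Z i0 0).
    have [|u bE] := iffLR (annYi i0 b).
      move=> j; rewrite -ZQ' mxE mulr_sumr big1 // => k _; rewrite mulrA.
      have [->|/Zi0->] := eqVneq k 0; last by rewrite mulr0 mul0r.
      by rewrite (left_mate_annl xb) mul0r.
    have [x [A' ZA']] : exists x A', equiv_mx Z (block_mx x%:M 0 0 A').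
      apply: (equiv_mx_pivot (i0 := i0) (j0 := 0)) => [j|i].
        have [->|/Zi0->] := eqVneq j 0; first by exists 1; rewrite mulr1.
        by exists 0; rewrite mulr0.
      have [->|ii0] := eqVneq i i0; first by exists 1; rewrite mul1r.
      have lt_i : (i < i0)%N by rewrite ltn_neqAle ii0 -ltnS ltn_ord.
      have [mi pmi dmi] := mate_d i.
      have /(proj2 dmi)[e ZE] : right_ann (iota (d i)) (Z i 0).
        rewrite /right_ann mxE mulr_sumr big1 // => k _.
        by rewrite mulrA dY mul0r.
      (* The goal is that [Z i 0 = mi * e] is killed by [b]. By the chain, [e * b] equals [d i * v]
         up to the kernel, and [mi] kills both parts. *)
      have [v vE] := chain i i0 (pi e * u) lt_i.
      apply/(proj1 xb); rewrite /left_ann ZE -mulrA.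
      rewrite -[e * b](subrK (iota (d i) * iota v)) mulrDr mulrA.
      rewrite [mi * iota _](@left_mate_annr S^c (iota (d i)) mi) // mul0r addr0.
      apply: kerM => //.
      by rewrite rmorphB !rmorphM /= !iotaK bE mulrA vE subrr.
    by exists x, A'; apply: equiv_mx_trans ZA'.
  + exact: pivot_of_inverses.
- exact: pivot_of_inverses.
Qed.

(** The diagonalisation of [pi A] lifts along [iota], leaving off-diagonal entries in the kernel; a
    corner outside the kernel divides those of its row and column. *)
Lemma mx_pivot n (A : 'M[S]_(1 + n)) :
  exists x A', equiv_mx A (block_mx x%:M 0 0 A').
Proof.
have [P [Q [d [invP invQ PAQ chain]]]] := elementary_divisor_chain edrR (map_mx pi A).
pose B := map_mx iota P *m A *m map_mx iota Q.
have AB : equiv_mx A B by apply: equiv_mx_mul; apply: invertible_iota.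
have piB i j : pi (B i j) = d i *+ ((i : nat) == j).
  have /matrixP/(_ i j) : map_mx pi B = P *m map_mx pi A *m Q.
    by rewrite !map_mxM !pi_iota_mx.
  by rewrite PAQ !mxE.
suff [x [A' BA']] : exists x A', equiv_mx B (block_mx x%:M 0 0 A').
  by exists x, A'; apply: equiv_mx_trans BA'.
(* If [d 0] vanishes, every later [d i] lies in [d 0 R], so all of [B] is in the kernel. *)
have [d0|d0] := eqVneq (d 0%N) 0.
  apply: ker_mx_pivot => i j; rewrite piB.
  suff -> : d i = 0 by rewrite mul0rn.
  have [->//|] := posnP i; move/(chain 0%N _ 1)=> [s].
  by rewrite mul1r d0 mul0r.
have pi00 : pi (B 0 0) != 0 by rewrite piB eqxx.
apply: (equiv_mx_pivot (i0 := 0) (j0 := 0)) => k.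
  have [->|k0] := eqVneq k 0; first by exists 1; rewrite mulr1.
  apply: (@ker_left_ideal S^c R^c pi piMc pi0 domRc kerMc (proj2 morS)) => //.
  by rewrite piB eq_sym; case: eqP => // k0'; case/eqP: k0; apply: val_inj.
have [->|k0] := eqVneq k 0; first by exists 1; rewrite mul1r.
apply: (ker_left_ideal piM pi0 domR kerM (proj1 morS)) => //.
by rewrite piB; case: eqP => // k0'; case/eqP: k0; apply: val_inj.
Qed.

Lemma split_extension_strongly_morphic : strongly_morphic S.
Proof.
by move=> n; apply: morphic_diagonalizable => //; exact: (diagonalizable_split mx_pivot).
Qed.

End SplitExtension.

(** * The trivial extension as a split square-zero extension *)

Section TrivialExtensionMaps.
Variables (R : nzRingType) (M : bimodType R).

Definition trivext_proj (x : trivext M) : R := x.1.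
Definition trivext_inj (r : R) : trivext M := (r, 0).

Lemma ract0 (m : M) : ract m 0 = 0.
Proof. by apply: (addrI (ract m 0)); rewrite -ractDr !addr0. Qed.

Lemma ract0l (r : R) : ract (0 : M) r = 0.
Proof. by apply: (addrI (ract (0 : M) r)); rewrite -ractDl !addr0. Qed.

Fact trivext_proj_is_zmod_morphism : zmod_morphism trivext_proj.
Proof. by []. Qed.

Fact trivext_proj_is_monoid_morphism : monoid_morphism trivext_proj.
Proof. by []. Qed.

HB.instance Definition _ := GRing.isZmodMorphism.Build (trivext M) R
  trivext_proj trivext_proj_is_zmod_morphism.
HB.instance Definition _ := GRing.isMonoidMorphism.Build (trivext M) R
  trivext_proj trivext_proj_is_monoid_morphism.

Fact trivext_inj_is_zmod_morphism : zmod_morphism trivext_inj.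
Proof. by move=> r s; congr (_, _); rewrite subr0. Qed.

Fact trivext_inj_is_monoid_morphism : monoid_morphism trivext_inj.
Proof. by split=> // r s; congr (_, _); rewrite /= scaler0 ract0l addr0. Qed.

HB.instance Definition _ := GRing.isZmodMorphism.Build R (trivext M)
  trivext_inj trivext_inj_is_zmod_morphism.
HB.instance Definition _ := GRing.isMonoidMorphism.Build R (trivext M)
  trivext_inj trivext_inj_is_monoid_morphism.

Lemma trivext_injK : cancel trivext_inj trivext_proj.
Proof. by []. Qed.

Lemma trivext_kerM (x y : trivext M) :
  trivext_proj x = 0 -> trivext_proj y = 0 -> x * y = 0.
Proof.
case: x y => [r m] [s n]; rewrite /trivext_proj /= => -> ->.
by congr (_, _); rewrite /= ?mul0r // scale0r ract0 addr0.
Qed.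

End TrivialExtensionMaps.

Theorem proposition30 (R : nzRingType) (M : bimodType R) :
  elementary_divisor_domain R ->
  morphic (trivext M) ->
  strongly_morphic (trivext M).
Proof.
move=> [domR edrR] morS.
exact: (split_extension_strongly_morphic (@trivext_injK R M) (@trivext_kerM R M)).
Qed.
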